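(* Let $R$ be a commutative noetherian ring admitting a dualizing complex, let $\mathfrak a$ be an ideal of $R$ and let $M$ be an $R$-module such that $\Gamma_{\mathfrak a}(M)=0$. Then $\Gamma_{\mathfrak a}(G(M))$ is reduced.
   Context: A dualizing complex for $R$ is a complex $D$ with bounded, finitely generated homology and finite injective dimension such that the homothety morphism $R\to\mathbf{R}\mathrm{Hom}_R(D,D)$ is an isomorphism in the derived category. An $R$-module $G$ is Gorenstein injective if there is an exact sequence $\mathcal I:\dots\to E_1\to E_0\to E_{-1}\to\dots$ of injective $R$-modules such that $\operatorname{Hom}_R(E,\mathcal I)$ is exact for every injective $R$-module $E$ and $G=\operatorname{Ker}(E_0\to E_{-1})$. A Gorenstein injective preenvelope of $M$ is a homomorphism $\phi:M\to G$ with $G$ Gorenstein injective such that every homomorphism from $M$ to a Gorenstein injective module factors through $\phi$; it is an envelope if moreover every $g:G\to G$ with $g\phi=\phi$ is an automorphism. Over $R$ every module $M$ has a Gorenstein injective envelope, denoted $M\to G(M)$. $\Gamma_{\mathfrak a}(M)=\{x\in M:\mathfrak a^nx=0\text{ for some }n\ge1\}$. A module is reduced if it has no non-zero injective submodule. *)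

(* Defs.v *)
From HB Require Import structures.
From mathcomp Require Import all_boot all_order all_algebra.
From mathcomp Require Import boolp.

Set Implicit Arguments.
Unset Strict Implicit.
Unset Printing Implicit Defensive.

Import GRing.Theory Num.Theory.
Local Open Scope ring_scope.

(** ** Submodules, ideals, injective modules *)

Definition submodule (R : pzRingType) (V : lmodType R) (S : submodClosed V) :=
  {x : V | x \in S}.

HB.instance Definition _ (R : pzRingType) (V : lmodType R)
  (S : submodClosed V) := SubChoice.on (submodule S).
HB.instance Definition _ (R : pzRingType) (V : lmodType R)
  (S : submodClosed V) := [SubChoice_isSubLmodule of submodule S by <:].

(* An ideal of R is a submodule of the regular module R^o; the unit ideal is
   allowed, unlike for mathcomp's [idealr]. *)
Definition noetherian_ring (R : comPzRingType) : Prop :=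
  forall J : submodClosed R^o, exists (n : nat) (g : 'I_n -> R),
    (forall k, g k \in J) /\
    forall x : R, x \in J -> exists c : 'I_n -> R, x = \sum_k c k * g k.

Definition injective_module (R : pzRingType) (E : lmodType R) : Prop :=
  forall (A B : lmodType R) (f : {linear A -> B}) (g : {linear A -> E}),
    injective f -> exists h : {linear B -> E}, forall x, h (f x) = g x.

Definition reduced_module (R : pzRingType) (V : lmodType R) : Prop :=
  forall S : submodClosed V,
    injective_module (submodule S) -> forall x, x \in S -> x = 0.

(** ** The a-torsion submodule *)

Fixpoint ideal_pow (R : comPzRingType) (a : submodClosed R^o) (n : nat) :
    R -> Prop :=
  match n with
  | 0 => fun=> True
  | m.+1 => fun r => exists s : seq (R * R),
      (forall p, p \in s -> p.1 \in a /\ ideal_pow a m p.2) /\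
      r = \sum_(p <- s) p.1 * p.2
  end.

Definition torsion_pred (R : comPzRingType) (a : submodClosed R^o)
    (M : lmodType R) : {pred M} :=
  fun x => `[< exists n : nat, (1 <= n)%N /\
                 forall r, ideal_pow a n r -> r *: x = 0 >].

Lemma ideal_powMl (R : comPzRingType) (a : submodClosed R^o) n (c r : R) :
  ideal_pow a n r -> ideal_pow a n (c * r).
Proof.
case: n => [//|n] /= [s [sP ->]].
exists [seq (c * p.1, p.2) | p <- s]; split.
  move=> _ /mapP[p /sP[pa pn] ->] /=; split => //.
  exact: (@rpredZ _ _ a c p.1 pa).
by rewrite big_map mulr_sumr; apply: eq_bigr => p _ /=; rewrite mulrA.
Qed.

Lemma ideal_powD (R : comPzRingType) (a : submodClosed R^o) n (r t : R) :
  ideal_pow a n r -> ideal_pow a n t -> ideal_pow a n (r + t).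
Proof.
case: n => [//|n] /= [s [sP ->]] [u [uP ->]].
exists (s ++ u); split; last by rewrite big_cat.
by move=> p; rewrite mem_cat => /orP[/sP|/uP].
Qed.

Lemma ideal_pow0 (R : comPzRingType) (a : submodClosed R^o) n :
  ideal_pow a n 0.
Proof. by case: n => [//|n]; exists [::]; rewrite big_nil. Qed.

Lemma ideal_pow_le (R : comPzRingType) (a : submodClosed R^o) m n (r : R) :
  (m <= n)%N -> ideal_pow a n r -> ideal_pow a m r.
Proof.
move=> /subnK <-; elim: (n - m)%N r => [//|k IHk] r /= [s [sP ->]].
elim: s sP => [|p s IHs] sP; first by rewrite big_nil; apply: ideal_pow0.
rewrite big_cons; apply: ideal_powD.
  by apply/ideal_powMl/IHk; have [] := sP p (mem_head _ _).
by apply: IHs => q qs; apply: sP; rewrite in_cons qs orbT.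
Qed.

Lemma torsion_submod_closed (R : comPzRingType) (a : submodClosed R^o)
  (M : lmodType R) : submod_closed (@torsion_pred R a M).
Proof.
split; first by apply/asboolP; exists 1%N; split => // r _; rewrite scaler0.
move=> c x y /asboolP[m [m1 xm]] /asboolP[n [n1 yn]]; apply/asboolP.
exists (maxn m n); split; first by rewrite leq_max m1.
move=> r rmn; rewrite scalerDr scalerA mulrC -scalerA xm ?scaler0 ?add0r.
  by apply/yn/(ideal_pow_le _ rmn)/leq_maxr.
by apply/(ideal_pow_le _ rmn)/leq_maxl.
Qed.

HB.instance Definition _ (R : comPzRingType) (a : submodClosed R^o)
    (M : lmodType R) :=
  GRing.isSubmodClosed.Build R M (@torsion_pred R a M)
    (@torsion_submod_closed R a M).

Definition torsion (R : comPzRingType) (a : submodClosed R^o)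
  (M : lmodType R) : submodClosed M := @torsion_pred R a M.

(** ** Complexes *)

(* Homological grading by int.  To avoid casts there is a map between any two
   degrees; it vanishes unless it goes from degree j + 1 to degree j. *)
Record complex (R : pzRingType) := Complex {
  ob :> int -> lmodType R;
  diff : forall i j, {linear ob i -> ob j};
  diff_shape : forall i j x, i != j + 1 -> diff i j x = 0;
  diff_diff : forall i j k x, diff j k (diff i j x) = 0
}.

Definition cycle (R : pzRingType) (C : complex R) (i : int) (x : C i) : Prop :=
  diff C i (i - 1) x = 0.

Definition boundary (R : pzRingType) (C : complex R) (i : int) (x : C i) :
  Prop := exists y : C (i + 1), diff C (i + 1) i y = x.

Definition exact_at (R : pzRingType) (C : complex R) (i : int) : Prop :=
  forall x : C i, cycle x -> boundary x.

Definition bounded_homology (R : pzRingType) (C : complex R) : Prop :=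
  exists n : nat, forall i : int, (n < `|i|)%N -> exact_at C i.

Definition fg_homology (R : pzRingType) (C : complex R) : Prop :=
  forall i : int, exists (n : nat) (g : 'I_n -> C i),
    (forall k, cycle (g k)) /\
    forall x : C i, cycle x ->
      exists c : 'I_n -> R, boundary (x - \sum_k c k *: g k).

Record chain_map (R : pzRingType) (C D : complex R) := ChainMap {
  cmap :> forall i, {linear C i -> D i};
  cmap_diff : forall i j x, cmap j (diff C i j x) = diff D i j (cmap i x)
}.

Definition quasi_iso (R : pzRingType) (C D : complex R) (f : chain_map C D) :
    Prop :=
  forall i : int,
    (forall x : C i, cycle x -> boundary (f i x) -> boundary x) /\
    (forall y : D i, cycle y -> exists x : C i, cycle x /\ boundary (f i x - y)).

Definition bounded_complex_of_injectives (R : pzRingType) (I : complex R) :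
    Prop :=
  (forall i, injective_module (I i)) /\
  exists n : nat, forall i : int, (n < `|i|)%N -> forall x : I i, x = 0.

(** ** Dualizing complexes *)

(* An element of degree n of the complex Hom_R(C, D) is a family of linear maps
   C_i -> D_(i + n); it is represented by its entries f i j with j = i + n, the
   other entries being irrelevant. *)
Definition hom_family (R : pzRingType) (C D : complex R) :=
  forall i j : int, {linear C i -> D j}.

(* d f - (-1)^n f d for f of degree n; meaningful for k = i + n - 1. *)
Definition hom_diff (R : pzRingType) (C D : complex R) (n : int)
    (f : hom_family C D) (i k : int) (x : C i) : D k :=
  diff D (k + 1) k (f i (k + 1) x)
  - (-1) ^+ `|n|%N *: f (i - 1) k (diff C i (i - 1) x).

Definition hom_cycle (R : pzRingType) (C D : complex R) (n : int)
    (f : hom_family C D) : Prop :=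
  forall (i k : int) (x : C i), k = i + n - 1 -> hom_diff n f k x = 0.

Definition hom_boundary (R : pzRingType) (C D : complex R) (n : int)
    (f : hom_family C D) : Prop :=
  exists h : hom_family C D, forall (i j : int) (x : C i),
    j = i + n -> f i j x = hom_diff (n + 1) h j x.

(* The map R -> Hom_R(D, I), r |-> r iota, with R in degree 0, induces an
   isomorphism on homology: injectivity in degree 0, surjectivity in degree 0,
   vanishing of the homology of Hom_R(D, I) in the other degrees. *)
Definition homothety_quasi_iso (R : comPzRingType) (D I : complex R)
    (iota : chain_map D I) : Prop :=
  [/\ forall r : R,
        (exists h : hom_family D I, forall (i : int) (x : D i),
           r *: iota i x = hom_diff 1 h i x) ->
        r = 0,
      forall f : hom_family D I, hom_cycle 0 f ->
        exists (r : R) (h : hom_family D I), forall (i : int) (x : D i),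
          f i i x = r *: iota i x + hom_diff 1 h i x
    & forall (n : int) (f : hom_family D I),
        n != 0 -> hom_cycle n f -> hom_boundary n f].

(* Finite injective dimension: D has a bounded injective resolution
   iota : D -> I.  Such an I computes RHom_R(D, -): RHom_R(D, D) is represented
   by Hom_R(D, I), and the homothety morphism by r |-> r iota. *)
Definition dualizing_complex (R : comPzRingType) (D : complex R) : Prop :=
  [/\ bounded_homology D,
      fg_homology D
    & exists (I : complex R) (iota : chain_map D I),
        [/\ bounded_complex_of_injectives I,
            quasi_iso iota
          & homothety_quasi_iso iota]].

(** ** Gorenstein injective envelopes *)

Definition hom_exact (R : pzRingType) (J : lmodType R) (C : complex R) : Prop :=
  forall (i : int) (f : {linear J -> C i}),
    (forall x, cycle (f x)) ->
    exists g : {linear J -> C (i + 1)},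
      forall x, diff C (i + 1) i (g x) = f x.

(* The equality G = Ker (E_0 -> E_(-1)) is up to isomorphism, given by u. *)
Definition gorenstein_injective (R : pzRingType) (G : lmodType R) : Prop :=
  exists E : complex R,
    [/\ forall i, injective_module (E i),
        forall i, exact_at E i,
        forall J : lmodType R, injective_module J -> hom_exact J E
      & exists u : {linear G -> E 0},
          injective u /\ forall x : E 0, cycle x <-> exists y, u y = x].

Definition gorenstein_injective_preenvelope (R : pzRingType)
    (M G : lmodType R) (phi : {linear M -> G}) : Prop :=
  gorenstein_injective G /\
  forall (H : lmodType R) (f : {linear M -> H}), gorenstein_injective H ->
    exists g : {linear G -> H}, forall x, g (phi x) = f x.

Definition gorenstein_injective_envelope (R : pzRingType)
    (M G : lmodType R) (phi : {linear M -> G}) : Prop :=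
  gorenstein_injective_preenvelope phi /\
  forall g : {linear G -> G}, (forall x, g (phi x) = phi x) -> bijective g.

(* Main.v *)
(** An injective module S inside the torsion of G meets phi(M) trivially, because
    phi is injective (every module embeds in an injective, hence Gorenstein
    injective, module) and M has no torsion.  So the projection S + phi(M) -> S
    extends to h : G -> S, and id - h fixes phi.  By the envelope property it is
    bijective, but it kills S, whence S = 0.  That there are enough injectives
    comes from the character modules Hom_Z(R, Q/Z). *)

Require Import Defs.
From HB Require Import structures.
From mathcomp Require Import all_boot all_order all_algebra.
From mathcomp Require Import boolp classical_sets.
Import GRing.Theory Num.Theory.
Local Open Scope ring_scope.

(** * Extension of additive maps into divisible groups *)

Lemma int_subgroup_gen (P : int -> Prop) :
    P 0 -> (forall j k, P j -> P k -> P (j - k)) ->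
  exists n : nat, P n%:Z /\ forall k, P k -> exists q, k = n%:Z * q.
Proof.
move=> P0 PB; have PN j : P j -> P (- j) by rewrite -sub0r; apply: PB.
have PM j q : P j -> P (j * q).
  move=> Pj; have Pn n : P (j * n%:Z).
    elim: n => [|n IHn]; first by rewrite mulr0.
    by rewrite -addn1 PoszD mulrDr mulr1 -[j in _ + j]opprK; apply/PB/PN.
  by case: q => n; rewrite ?NegzE ?mulrN; last apply: PN; apply: Pn.
(* Without positive elements the subgroup is zero and n = 0; otherwise its least positive element
   generates it, by Euclidean division. *)
have [exP|nP] := pselect (exists n, (0 < n)%N && `[< P n%:Z >]); last first.
  exists 0; split=> // k Pk; exists 0; rewrite mulr0.
  case: k Pk => [[//|n]|n] Pk; case: nP; exists n.+1; apply/asboolP=> //.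
  by rewrite -[Posz _]opprK -NegzE; apply: PN.
case: (ex_minnP exP) => n /andP[n_gt0 /asboolP Pn] n_min.
exists n; split=> // k Pk; exists (k %/ n%:Z)%Z.
have: P (k %% n%:Z)%Z by rewrite /modz mulrC; apply/PB/PM.
have r_ge0 : 0 <= (k %% n%:Z)%Z by rewrite modz_ge0 // -lt0n.
have r_lt : (k %% n%:Z)%Z < n%:Z by rewrite ltz_pmod.
case Er: (k %% n%:Z)%Z r_ge0 r_lt => [[|r]|//] _ r_lt Pr; last first.
  have /n_min : (0 < r.+1)%N && `[< P r.+1%:Z >] by apply/asboolP.
  by rewrite leqNgt -ltz_nat r_lt.
by rewrite {1}(divz_eq k n%:Z) Er addr0 mulrC.
Qed.

Section AdditiveExtension.
Variables (B D : zmodType).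

(** The graph of an additive map on a subgroup of B, or the empty set. Given closure under
    differences, single-valuedness need only be tested at 0. *)
Definition partial_additive (F : set (B * D)) : Prop :=
  (forall p q, F p -> F q -> F (p.1 - q.1, p.2 - q.2)) /\
  (forall y, F (0, y) -> y = 0).

Lemma graph_0 (F : set (B * D)) p : partial_additive F -> F p -> F (0, 0).
Proof. by move=> [FB _] Fp; rewrite -(subrr p.1) -(subrr p.2); apply: FB. Qed.

Lemma graph_mulrz (F : set (B * D)) x y k :
  partial_additive F -> F (x, y) -> F (x *~ k, y *~ k).
Proof.
move=> FG Fxy; have [FB _] := FG; have F0 := graph_0 _ _ FG Fxy.
have FN u v : F (u, v) -> F (- u, - v).
  by move=> Fuv; have := FB _ _ F0 Fuv; rewrite /= !sub0r.
have Fn n : F (x *+ n, y *+ n).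
  elim: n => [|n IHn]; first by rewrite !mulr0n.
  by have := FB _ _ IHn (FN _ _ Fxy); rewrite /= !opprK -!mulrSr.
by case: k => n; rewrite ?NegzE ?mulrNz; last apply: FN; rewrite -!pmulrn; apply: Fn.
Qed.

(** Adjoins x to the domain with value y. The hypothesis makes y agree with F on the multiples of x
    already in the domain, so the larger graph stays single-valued. *)
Lemma graph_extend (F : set (B * D)) x y : partial_additive F ->
    (forall k d, F (x *~ k, d) -> d = y *~ k) ->
  partial_additive [set p | exists k, F (p.1 - x *~ k, p.2 - y *~ k)]%classic.
Proof.
move=> [FB F1] Fxy; split=> [[b d] [b' d'] [k Fk] [k' Fk']|d [k]] /=.
  exists (k - k'); have := FB _ _ Fk Fk' => /=.
  by rewrite !mulrzBr !opprD !(addrACA _ (- (_ *~ k))).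
rewrite sub0r -mulrNz => /Fxy; rewrite mulrNz => /eqP.
by rewrite -subr_eq0 opprK subrK => /eqP.
Qed.

Hypothesis D_div : forall n (d : D), (0 < n)%N -> exists e : D, e *+ n = d.

(** The k for which k x lies in the domain form a subgroup nZ. Dividing the value at n x by n gives
    y; if n = 0, that value is 0 and y = 0 will do. *)
Lemma graph_value (F : set (B * D)) x : F (0, 0) -> partial_additive F ->
  exists y, forall k d, F (x *~ k, d) -> d = y *~ k.
Proof.
move=> F0 FG; have [FB F1] := FG.
have [||n [[d0 Fd0] n_gen]] := @int_subgroup_gen (fun k => exists d, F (x *~ k, d)).
- by exists 0.
- by move=> j k [d Fd] [e Fe]; exists (d - e); rewrite mulrzBr; apply: FB _ _ Fd Fe.
have [y yn] : exists y, y *+ n = d0.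
  case: n Fd0 {n_gen} => [|n] Fd0; last exact: D_div.
  by exists 0; rewrite (F1 d0).
exists y => k d Fkd; have [q kE] := n_gen k (ex_intro _ d Fkd).
have := FB _ _ Fkd (graph_mulrz _ _ _ q FG Fd0).
rewrite /= kE !mulrzA subrr => /F1/eqP.
by rewrite subr_eq0 -yn => /eqP.
Qed.

(** Zorn's lemma gives a maximal graph above F. It is total, since [graph_value] and [graph_extend]
    would adjoin any missing point. *)
Lemma additive_extension (F : set (B * D)) : F (0, 0) -> partial_additive F ->
  exists chi : B -> D, zmod_morphism chi /\ forall b d, F (b, d) -> chi b = d.
Proof.
move=> F0 FG.
(* The empty set is allowed for the sake of the empty chain. *)
pose P (A : set (B * D)) := partial_additive A /\ ((exists p, A p) -> (F `<=` A)%classic).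
have [|A [[AG FA] A_max]] := @Zorn_bigcup _ P.
  move=> C CP C_tot; split; last first.
    by move=> [p [X CX Xp]] q Fq; exists X => //; apply: (CP X CX).2 Fq; exists p.
  split=> [p q [X CX Xp] [Y CY Yq]|y [X CX]]; last exact: (CP X CX).1.2.
  have [XY|YX] := C_tot X Y CX CY.
    by exists Y => //; apply: (CP Y CY).1.1 => //; apply: XY.
  by exists X => //; apply: (CP X CX).1.1 => //; apply: YX.
(* The maximal A is not empty, as otherwise F would be strictly larger. *)
have {}FA : (F `<=` A)%classic.
  apply: FA; apply: contrapT => A0; apply: (A_max F); last by split=> [|_ p].
  split=> [p Ap|FA0]; first by case: A0; exists p.
  by apply: A0; exists (0, 0); apply: FA0.
have A_tot b : exists d, A (b, d).
  have [y Ay] := graph_value _ b (FA _ F0) AG.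
  apply: contrapT => nAb; apply: (A_max _ _ (conj (graph_extend _ _ _ AG Ay) _)).
    split=> [[u v] Auv|sub]; first by exists 0; rewrite !mulr0z !subr0.
    apply: nAb; exists y; apply: sub; exists 1.
    by rewrite !mulr1z !subrr; apply: FA.
  by move=> _ [u v] /FA Auv; exists 0; rewrite !mulr0z !subr0.
have [chi Achi] := choice A_tot; exists chi.
have uniqA b d : A (b, d) -> chi b = d.
  move=> /(AG.1 _ _ (Achi b)); rewrite /= subrr => /AG.2/eqP.
  by rewrite subr_eq0 => /eqP.
split=> [u v|b d /FA/uniqA //].
by apply: uniqA; apply: (AG.1 _ _ (Achi u) (Achi v)).
Qed.

End AdditiveExtension.

(** * The group Q/Z and its characters *)

Definition rat_int : {pred rat} := fun x => x \is a Num.int.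

Lemma rat_int_zmod_closed : zmod_closed rat_int.
Proof. by split=> [|x y xz yz]; [apply: rpred0 | apply: rpredB]. Qed.

HB.instance Definition _ :=
  GRing.isZmodClosed.Build rat rat_int rat_int_zmod_closed.

Definition QmodZ : zmodType := Quotient.quot rat_int.
Definition toQmodZ (x : rat) : QmodZ := (\pi_(Quotient.quot rat_int) x)%qT.

Lemma toQmodZ_is_zmod_morphism : zmod_morphism toQmodZ.
Proof. by move=> x y; rewrite /toQmodZ raddfB. Qed.

HB.instance Definition _ :=
  GRing.isZmodMorphism.Build rat QmodZ toQmodZ toQmodZ_is_zmod_morphism.

Lemma toQmodZ_eq0 x : (toQmodZ x == 0) = (x \is a Num.int).
Proof.
rewrite -(raddf0 toQmodZ).
by have /= <- := Quotient.idealrBE rat_int x 0; rewrite subr0.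
Qed.

Lemma QmodZ_divisible n (d : QmodZ) : (0 < n)%N -> exists e : QmodZ, e *+ n = d.
Proof.
move=> n_gt0; pose x := repr (d : Quotient.quot rat_int).
exists (toQmodZ (x / n%:R)); rewrite -raddfMn -(mulr_natr (x / _)) divfK.
  exact: reprK.
by rewrite pnatr_eq0 -lt0n.
Qed.

(** Here n stands for the order of a non-zero group element, 0 meaning infinite order. The class of
    1/n serves for n at least 2, that of 1/2 for n = 0. *)
Lemma QmodZ_torsion n : n != 1%N -> exists2 y : QmodZ, y != 0 & y *+ n = 0.
Proof.
have inv_nint m : toQmodZ m.+2%:R^-1 != 0.
  rewrite toQmodZ_eq0; apply/negP => /norm_intr_ge1.
  rewrite invr_eq0 pnatr_eq0 normfV normr_nat => /(_ isT).
  by rewrite invr_ge1 ?unitfE ?pnatr_eq0 ?ltr0n // lern1.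
case: n => [|[//|n]] _; first by exists (toQmodZ 2%:R^-1).
exists (toQmodZ n.+2%:R^-1) => //; rewrite -raddfMn -(mulr_natr _^-1) mulVf ?pnatr_eq0 //.
by apply/eqP; rewrite toQmodZ_eq0.
Qed.

(** A non-zero y killed by the order of b defines a character on the cyclic group of b, which
    extends to B. *)
Lemma character_neq0 (B : zmodType) (b : B) : b != 0 ->
  exists2 chi : B -> QmodZ, zmod_morphism chi & chi b != 0.
Proof.
move=> b_neq0.
have [||n [bn n_gen]] := @int_subgroup_gen (fun k => b *~ k = 0).
- by rewrite mulr0z.
- by move=> j k bj bk; rewrite mulrzBr bj bk subr0.
have [|y y_neq0 yn] := @QmodZ_torsion n.
  by apply: contra_neq b_neq0 => n1; rewrite -bn n1.
(* Adjoining (b, y) to the graph of the zero subgroup gives the character on the multiples of b. *)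
pose F : set (B * QmodZ) := [set (0, 0)]%classic.
have FG : partial_additive _ _ F.
  by split=> [_ _ -> ->|z [->]] //; rewrite !subr0.
have Fy k d : F (b *~ k, d) -> d = y *~ k.
  by case=> /n_gen[q ->] ->; rewrite mulrzA -pmulrn yn mul0rz.
have [|chi [chiB chiE]] :=
  additive_extension _ _ QmodZ_divisible _ _ (graph_extend _ _ _ _ _ FG Fy).
  by exists 0; rewrite /= !mulr0z !subr0.
by exists chi => //; rewrite (chiE b y) //; exists 1; rewrite /= !mulr1z !subrr.
Qed.

(** * The coinduced module Hom_Z(R, D) and enough injectives *)

Record character_module (R D : zmodType) := CharacterModule {
  character_fun :> R -> D;
  character_funB : zmod_morphism character_fun
}.

HB.instance Definition _ R D := gen_eqMixin (character_module R D).
HB.instance Definition _ R D := gen_choiceMixin (character_module R D).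

Section CharacterModule.
Variables (R : comPzRingType) (D : zmodType).
Local Notation charmod := (character_module R D).
Implicit Types f g h : charmod.

HB.instance Definition _ f :=
  GRing.isZmodMorphism.Build R D f (character_funB _ _ f).

Lemma character_eq f g : f =1 g -> f = g.
Proof.
case: f g => [f fB] [g gB] /= /funext fg.
by case: _ / fg in gB *; congr CharacterModule; apply: Prop_irrelevance.
Qed.

Lemma character_zero_subproof : zmod_morphism (fun _ : R => 0 : D).
Proof. by move=> x y; rewrite subr0. Qed.
Lemma character_opp_subproof f : zmod_morphism (fun r => - f r).
Proof. by move=> x y; rewrite raddfB opprD. Qed.
Lemma character_add_subproof f g : zmod_morphism (fun r => f r + g r).
Proof. by move=> x y; rewrite !raddfB opprD addrACA. Qed.
Lemma character_scale_subproof a f : zmod_morphism (fun r => f (r * a)).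
Proof. by move=> x y; rewrite mulrBl raddfB. Qed.

Definition character_zero : charmod := CharacterModule _ _ _ character_zero_subproof.
Definition character_opp f : charmod :=
  CharacterModule _ _ _ (character_opp_subproof f).
Definition character_add f g : charmod :=
  CharacterModule _ _ _ (character_add_subproof f g).
Definition character_scale a f : charmod :=
  CharacterModule _ _ _ (character_scale_subproof a f).

Lemma character_addA : associative character_add.
Proof. by move=> f g h; apply: character_eq => r /=; rewrite addrA. Qed.
Lemma character_addC : commutative character_add.
Proof. by move=> f g; apply: character_eq => r /=; rewrite addrC. Qed.
Lemma character_add0 : left_id character_zero character_add.
Proof. by move=> f; apply: character_eq => r /=; rewrite add0r. Qed.
Lemma character_addN : left_inverse character_zero character_opp character_add.
Proof. by move=> f; apply: character_eq => r /=; rewrite addNr. Qed.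

HB.instance Definition _ := GRing.isZmodule.Build charmod
  character_addA character_addC character_add0 character_addN.

Lemma character_scaleA a b f :
  character_scale a (character_scale b f) = character_scale (a * b) f.
Proof. by apply: character_eq => r /=; rewrite mulrA. Qed.
Lemma character_scale1 : left_id 1 character_scale.
Proof. by move=> f; apply: character_eq => r /=; rewrite mulr1. Qed.
Lemma character_scaleDr : right_distributive character_scale +%R.
Proof. by move=> a f g; apply: character_eq. Qed.
Lemma character_scaleDl f : {morph character_scale^~ f : a b / a + b}.
Proof. by move=> a b; apply: character_eq => r /=; rewrite mulrDr raddfD. Qed.

HB.instance Definition _ := GRing.Zmodule_isLmodule.Build R charmod
  character_scaleA character_scale1 character_scaleDr character_scaleDl.

Section OfCharacter.
Variables (V : lmodType R) (chi : V -> D) (chiB : zmod_morphism chi).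

Lemma orbit_character_subproof v : zmod_morphism (fun r : R => chi (r *: v)).
Proof. by move=> r s; rewrite scalerBl chiB. Qed.

(** The adjunction from Hom_Z(V, D) to Hom_R(V, Hom_Z(R, D)); evaluation at 1 is its inverse. *)
Definition orbit_character v : charmod :=
  CharacterModule _ _ _ (orbit_character_subproof v).

Lemma orbit_character_is_linear : linear orbit_character.
Proof.
pose chi' : {additive V -> D} := HB.pack chi (GRing.isZmodMorphism.Build V D chi chiB).
move=> a u v; apply: character_eq => r /=; rewrite scalerDr scalerA.
exact: (raddfD chi').
Qed.

HB.instance Definition _ := GRing.isLinear.Build R V charmod *:%R orbit_character
  orbit_character_is_linear.

End OfCharacter.

(** By the adjunction, extending g along f amounts to extending the additive map f a |-> (g a) 1
    from the image of f to B. *)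
Lemma character_module_injective :
    (forall n (d : D), (0 < n)%N -> exists e : D, e *+ n = d) ->
  injective_module charmod.
Proof.
move=> D_div A B f g f_inj.
pose F : set (B * D) := [set p | exists a, p = (f a, (g a : charmod) 1)]%classic.
have [||chi [chiB chiE]] := additive_extension _ _ D_div F.
- by exists 0; rewrite !raddf0.
- split=> [_ _ [a ->] [b ->]|d [a []]]; first by exists (a - b); rewrite !raddfB.
  by rewrite -(raddf0 f) => /f_inj <- ->; rewrite raddf0.
exists (orbit_character B chi chiB) => a; apply: character_eq => r /=.
rewrite -linearZ (chiE _ ((g (r *: a) : charmod) 1)); last by exists (r *: a).
by rewrite linearZ /= mul1r.
Qed.

End CharacterModule.

(** Hom_Z(R, Q/Z) is an injective cogenerator. Separating one element at a time is enough to prove a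
    map injective and avoids embedding V in a product. *)
Lemma injective_separates {R : comPzRingType} {V : lmodType R} (x : V) : x != 0 ->
  exists E : lmodType R, injective_module E /\ exists f : {linear V -> E}, f x != 0.
Proof.
move=> /character_neq0[chi chiB chix].
exists (character_module R QmodZ); split.
  by apply: character_module_injective; apply: QmodZ_divisible.
exists (orbit_character _ _ V chi chiB); apply: contra_neq chix => fx0.
by rewrite -(scale1r x) -[LHS]/(orbit_character _ _ V chi chiB x 1) fx0.
Qed.

(** * Injective modules are Gorenstein injective *)

Lemma injective_module_prod {R : pzRingType} {E F : lmodType R} :
  injective_module E -> injective_module F -> injective_module (E * F)%type.
Proof.
move=> Einj Finj A B f g f_inj.
have [h hE] := Einj _ _ f (fst \o g) f_inj.
have [k kE] := Finj _ _ f (snd \o g) f_inj.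
have hk_lin : linear (fun b => (h b, k b)) by move=> a u v; rewrite !linearP.
pose hk : {linear B -> (E * F)%type} :=
  HB.pack (fun b => (h b, k b)) (GRing.isLinear.Build _ _ _ _ _ hk_lin).
by exists hk => a; rewrite /= hE kE /=; case: (g a).
Qed.

(* E is Gorenstein injective through the complex with E x E in every degree and
   differential (x, y) |-> (y, 0); a complex concentrated in two degrees would
   need a case analysis on the degree in the type of the modules. *)
Section ShiftComplex.
Variables (R : pzRingType) (E : lmodType R).

Definition shift_pair (p : (E * E)%type) : (E * E)%type := (p.2, 0).

Lemma shift_pair_is_linear : linear shift_pair.
Proof. by move=> a p q; congr pair; rewrite /= scaler0 addr0. Qed.

HB.instance Definition _ :=
  GRing.isLinear.Build R (E * E)%type (E * E)%type *:%R shift_pair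
    shift_pair_is_linear.

Definition shift_diff (i j : int) : {linear (E * E)%type -> (E * E)%type} :=
  if i == j + 1 then (shift_pair : {linear _ -> _}) else (\0 : {linear _ -> _}).

Lemma shift_diff_shape i j x : i != j + 1 -> shift_diff i j x = 0.
Proof. by rewrite /shift_diff => /negPf ->. Qed.

Lemma shift_diff_diff i j k x : shift_diff j k (shift_diff i j x) = 0.
Proof. by rewrite /shift_diff; do 2!case: ifP => _. Qed.

Definition shift_complex : complex R :=
  Complex (ob := fun=> (E * E)%type) shift_diff_shape shift_diff_diff.

Lemma shift_cycleP i (x : shift_complex i) :
  Defs.cycle x <-> (x : (E * E)%type).2 = 0.
Proof.
case: x => x y; rewrite /Defs.cycle /= /shift_diff subrK eqxx.
by split=> [[]|/= ->].
Qed.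

Lemma shift_diffS i (x : shift_complex (i + 1)) :
  diff shift_complex (i + 1) i x = shift_pair x.
Proof. by rewrite /= /shift_diff eqxx. Qed.

End ShiftComplex.

(** The map (x, y) |-> (0, x) is a contracting homotopy of the shift complex: it lifts cycles, and
    likewise linear maps with values in cycles. The cycles in degree 0 are E x 0, a copy of E. *)
Lemma injective_gorenstein {R : pzRingType} {E : lmodType R} :
  injective_module E -> gorenstein_injective E.
Proof.
move=> Einj; exists (shift_complex R E); split.
- by move=> i; apply: injective_module_prod.
- move=> i [x y] /shift_cycleP /= ->; exists (0, x).
  by rewrite shift_diffS.
- move=> J _ i f fZ.
  have g_lin : linear (fun z => (0 : E, (f z : (E * E)%type).1)).
    by move=> a u v; rewrite linearP; congr pair; rewrite /= scaler0 addr0.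
  pose g : {linear J -> (E * E)%type} :=
    HB.pack (fun z => (0 : E, (f z : (E * E)%type).1))
      (GRing.isLinear.Build _ _ _ _ _ g_lin).
  exists g => z; rewrite shift_diffS /= /shift_pair /=.
  by have /shift_cycleP := fZ z; case: (f z) => u v /= ->.
have u_lin : linear (fun x : E => (x, 0 : E)).
  by move=> a u v; congr pair; rewrite /= scaler0 addr0.
pose u : {linear E -> (E * E)%type} :=
  HB.pack (fun x : E => (x, 0 : E)) (GRing.isLinear.Build _ _ _ _ _ u_lin).
exists u; split=> [x y [] //|[x y]].
split=> [/shift_cycleP /= ->|[z <-]]; first by exists x.
exact/shift_cycleP.
Qed.

(** * Preenvelopes, torsion and the splitting argument *)

(** A map to an injective module that does not kill x factors through [phi], so [phi] does not kill
    x either. *)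
Lemma gorenstein_preenvelope_injective {R : comPzRingType} {M G : lmodType R}
    (phi : {linear M -> G}) :
  gorenstein_injective_preenvelope phi -> injective phi.
Proof.
move=> [_ phi_pre]; apply: raddf_inj => x phix0; apply: contrapT => /eqP.
move=> /injective_separates[E [/injective_gorenstein Einj [f /eqP]]]; case.
by have [g <-] := phi_pre E f Einj; rewrite phix0 raddf0.
Qed.

Lemma torsion_image {R : comPzRingType} (a : submodClosed R^o) {M G : lmodType R}
    {phi : {linear M -> G}} x : injective phi ->
  phi x \in torsion a G -> x \in torsion a M.
Proof.
move=> phi_inj /asboolP[n [n1 xn]]; apply/asboolP; exists n; split=> // r rn.
by apply: phi_inj; rewrite linearZ raddf0; apply: xn.
Qed.

Theorem proposition2p11 (R : comPzRingType) (R_noeth : noetherian_ring R)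
    (R_dual : exists D : complex R, dualizing_complex D)
    (a : submodClosed R^o) (M : lmodType R)
    (M_torsionfree : forall x : M, x \in torsion a M -> x = 0)
    (G : lmodType R) (phi : {linear M -> G})
    (phi_envelope : gorenstein_injective_envelope phi) :
  reduced_module (submodule (torsion a G)).
Proof.
case: phi_envelope => phi_pre phi_env S S_inj x xS.
have phi_inj := gorenstein_preenvelope_injective _ phi_pre.
pose i : {linear submodule S -> G} := val \o val.
have i_inj : injective i by move=> u v /val_inj/val_inj.
(* The external sum S x M, embedded by [j], replaces the internal sum of S and phi(M), so that the
   projection is just [fst]. *)
pose j (p : (submodule S * M)%type) := i p.1 + phi p.2.
have j_lin : linear j.
  by move=> c p q; rewrite /j !linearP scalerDr addrACA.
pose jL : {linear (submodule S * M)%type -> G} :=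
  HB.pack j (GRing.isLinear.Build _ _ _ _ _ j_lin).
have j_inj : injective jL.
  apply: raddf_inj => -[e m] /eqP; rewrite /= /j addr_eq0 => /eqP em.
  (* Here phi m = - i e is torsion in G, so m is torsion in M. *)
  have m0 : m = 0.
    apply: M_torsionfree; apply: (torsion_image a _ phi_inj).
    by rewrite -[phi m]opprK -em rpredN; apply: valP.
  by congr pair => //; apply: i_inj; rewrite em m0 !raddf0 ?oppr0.
have [h hE] := S_inj _ _ jL fst j_inj.
have h_i e : h (i e) = e by rewrite -[RHS](hE (e, 0)) /= /j raddf0 addr0.
have h_phi m : h (phi m) = 0 by rewrite -[RHS](hE (0, m)) /= /j raddf0 add0r.
have g_fix m : (idfun \- (i \o h)) (phi m) = phi m.
  by rewrite -[LHS]/(phi m - i (h (phi m))) h_phi (raddf0 i) subr0.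
have /bij_inj g_inj := phi_env (idfun \- (i \o h)) g_fix.
have [e ex] : exists e : submodule S, val e = x by exists (exist _ x xS).
(* Both i e and 0 are sent to 0 by id - i h, because h (i e) = e. *)
apply: val_inj; rewrite -ex; apply: g_inj.
by rewrite raddf0 -[LHS]/(i e - i (h (i e))) h_i subrr.
Qed.
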